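(* Let $K$ be a triangulation of an open domain in $\mathbb{C}$ whose 1-skeleton $K^{(1)}$ is recurrent. Let $\rho,\tilde\rho:K^{(0)}\to(0,\infty)$ be labels for $K$, and suppose that $K(\tilde\rho)$ is a subpacking for $\Theta_\rho$, i.e. $\Theta_{\tilde\rho}(v)\ge\Theta_\rho(v)$ for every $v\in K^{(0)}$. Then the function $A:K^{(0)}\to(0,\infty)$, $A(v):=\tilde\rho(v)/\rho(v)$, is bounded if and only if it is constant.
   Context: $K$ is a simplicial 2-complex given by a triangulation of a domain in $\mathbb{C}$ (connected open set), infinite and without boundary, with vertex set $K^{(0)}$ (every vertex is interior), edge set $K^{(1)}$ (also denoting the 1-skeleton graph), and face set $K^{(2)}$; every vertex has finitely many neighbors. A label for $K$ is a function $\rho:K^{(0)}\to(0,\infty)$; $K(\rho)$ denotes $K$ with label $\rho$. For a face $\triangle=\langle u,v,w\rangle$ put $$\alpha_\rho(v,\triangle):=\arccos\left[\frac{(\rho(v)+\rho(u))^2+(\rho(v)+\rho(w))^2-(\rho(u)+\rho(w))^2}{2(\rho(v)+\rho(u))(\rho(v)+\rho(w))}\right],$$ the angle at the vertex corresponding to $v$ in the euclidean triangle formed by the centers of three mutually externally tangent circles of radii $\rho(u),\rho(v),\rho(w)$. The angle sum at an interior vertex $v$ is $\Theta_\rho(v):=\sum_{\triangle}\alpha_\rho(v,\triangle)$, the sum over all faces $\triangle\in K^{(2)}$ containing $v$. A labelled complex $K(\tilde\rho)$ is a subpacking for a function $\Theta$ on the interior vertices if $\Theta_{\tilde\rho}\ge\Theta$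 pointwise. A graph is recurrent if its simple random walk (from a vertex move to each neighbor with equal probability) is recurrent, i.e. visits every vertex infinitely many times with probability 1. *)

(* Defs.v *)
From HB Require Import structures.
From mathcomp Require Import all_boot all_order all_algebra finmap complex.
From mathcomp Require Import all_classical all_reals all_analysis.

Set Implicit Arguments.
Unset Strict Implicit.
Unset Printing Implicit Defensive.

Import Order.TTheory GRing.Theory Num.Theory numFieldNormedType.Exports.

Local Open Scope classical_set_scope.
Local Open Scope fset_scope.
Local Open Scope ring_scope.

(* Every element of the type V is a vertex. *)
Record simplicial2 (V : choiceType) := Simplicial2 {
  edges : set {fset V};
  faces : set {fset V};
  card_edge : forall e, edges e -> #|` e| = 2%N;
  card_face : forall t, faces t -> #|` t| = 3%N;
  edge_of_face : forall t e, faces t -> e `<=` t -> #|` e| = 2%N -> edges e }.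

Section Combinatorics.
Variables (V : choiceType) (K : simplicial2 V).

(* Irreflexive since edges have exactly two elements. *)
Definition neighbor (u v : V) : Prop := edges K [fset u; v].

Definition simplex (s : {fset V}) : Prop :=
  (exists v, s = [fset v]) \/ edges K s \/ faces K s.

(* The star of v is a closed disc around v: the neighbors of v can be
   arranged in a cycle s such that the faces at v are exactly the triangles
   spanned by v and two cyclically consecutive elements of s. *)
Definition interior_vertex (v : V) : Prop :=
  exists s : seq V, [/\ uniq s, (2 < size s)%N,
    (forall u, neighbor v u <-> u \in s) &
    (forall t, faces K t /\ v \in t <->
       exists2 u, u \in s & t = [fset v; u; next s u])].

End Combinatorics.

Section Triangulation.
Variables (R : realType) (V : choiceType) (K : simplicial2 V).

(* |K| in barycentric coordinates. It is used below with the topology of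
   pointwise convergence, which on |K| agrees with the weak (CW) topology
   as K is locally finite. *)
Definition realization : set {ptws V -> R} :=
  [set x | exists s, [/\ simplex K s, (forall v, 0 <= x v),
     (forall v, v \notin s -> x v = 0) & \sum_(v <- s) x v = 1]].

(* The alias ^o gives R[i] its norm topology, i.e. that of the plane. *)
Definition plane_domain (D : set R[i]^o) : Prop :=
  [/\ D !=set0, open D & connected D].

Definition homeomorphic_to (D : set R[i]^o) : Prop :=
  exists (h : {ptws V -> R} -> R[i]^o) (g : R[i]^o -> {ptws V -> R}),
    [/\ set_bij realization D h, (forall x, realization x -> g (h x) = x),
        {within realization, continuous h} & {within D, continuous g}].

(* For a locally finite complex homeomorphic to a plane domain, the first and
   third conditions hold automatically. *)
Definition triangulation (D : set R[i]^o) : Prop :=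
  [/\ infinite_set [set: V],
      (forall v, finite_set [set u | neighbor K v u]),
      (forall v, interior_vertex K v) &
      homeomorphic_to D].

End Triangulation.

Section Labels.
Variables (R : realType) (V : choiceType).
Implicit Types (rho : V -> R) (v : V) (t : {fset V}).

Definition angle3 rho v u w : R :=
  acos (((rho v + rho u) ^+ 2 + (rho v + rho w) ^+ 2 - (rho u + rho w) ^+ 2)
        / (2 * (rho v + rho u) * (rho v + rho w))).

(* angle3 rho v u w is symmetric in u and w, so the order in which t `\ v is
   enumerated is irrelevant. The default value is not used for faces t
   containing v. *)
Definition angle rho v t : R :=
  if enum_fset (t `\ v) is [:: u; w] then angle3 rho v u w else 0.

Definition angle_sum (K : simplicial2 V) rho v : R :=
  \sum_(t \in [set t | faces K t /\ v \in t]) angle rho v t.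

Definition subpacking (K : simplicial2 V) rho (Theta : V -> R) : Prop :=
  forall v, interior_vertex K v -> Theta v <= angle_sum K rho v.

End Labels.

Section RandomWalk.
Variables (R : realType) (V : choiceType) (adj : V -> V -> Prop).

Definition degree (v : V) : nat := #|` fset_set [set u | adj v u]|.

Definition step (u v : V) : R := if `[< adj u v >] then (degree u)%:R^-1 else 0.

(* X is the simple random walk started at x. The value p i of the prescribed
   path matters only for i <= n. *)
Definition simple_random_walk (x : V) d (T : measurableType d)
    (P : probability T R) (X : nat -> T -> V) : Prop :=
  (forall n v, measurable (X n @^-1` [set v])) /\
  (forall n (p : nat -> V),
     P [set w | forall i, (i <= n)%N -> X i w = p i] =
     ((p 0%N == x)%:R * \prod_(i < n) step (p i) (p i.+1))%:E).

(* The law of the walk is determined by simple_random_walk, so it does not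
   matter on which probability space it is realized. *)
Definition recurrent : Prop :=
  forall x : V, exists (d : measure_display) (T : measurableType d)
      (P : probability T R) (X : nat -> T -> V),
    simple_random_walk x P X /\
    {ae P, forall w, forall v, infinite_set [set n | X n w = v]}.

End RandomWalk.

(* Main.v *)
(* Join rho to rhot by the labels rho^(1-t) * rhot^t. In a triangle of mutually
   tangent circles the derivative of the angle at u with respect to the
   logarithm of the radius at v is r / |uv|, where r is the inradius; this is
   symmetric in u and v and at most 1/2. By the mean value theorem, tested
   against any function, the difference of the angle sums is the Laplacian of
   w = ln (rhot / rho) for symmetric conductances at most 1/2 on each face, so
   that w is subharmonic. If A is bounded, h = M - w is positive for some M, and
   testing against f^2 / h (Caccioppoli) bounds a weighted energy of ln h by the
   Dirichlet energy of f. By recurrence, cutoffs f with f(o) = 1 have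
   arbitrarily small energy, so h is constant along edges; recurrence also makes
   the graph connected. *)
Require Import Defs.
From mathcomp Require Import all_boot all_order all_algebra finmap complex.
From mathcomp Require Import all_classical all_reals all_analysis.
From mathcomp Require Import ring lra.

Set Implicit Arguments.
Unset Strict Implicit.
Unset Printing Implicit Defensive.

Import Order.TTheory GRing.Theory Num.Theory numFieldNormedType.Exports.

Local Open Scope classical_set_scope.
Local Open Scope ring_scope.

(** * Angles of triangles of mutually tangent circles *)

Section Triangle.
Variable R : realType.
Implicit Types a b c : R.

Definition tri_cos a b c : R :=
  ((a + b) ^+ 2 + (a + c) ^+ 2 - (b + c) ^+ 2) / (2 * (a + b) * (a + c)).

(** Heron's formula: the triangle has semiperimeter $a+b+c$ and area $\sqrt{(a+b+c)abc}$; the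
    inradius is area over semiperimeter. *)
Definition inradius a b c : R := Num.sqrt (a * b * c / (a + b + c)).

(** Half-angle form: the fraction multiplied by 2 is the squared sine of half the angle. *)
Lemma tri_cosE a b c : 0 < a -> 0 < b -> 0 < c ->
  tri_cos a b c = 1 - 2 * (b * c * ((a + b) * (a + c))^-1).
Proof.
move=> a0 b0 c0; rewrite /tri_cos; field.
by rewrite !lt0r_neq0 ?addr_gt0.
Qed.

Lemma inradius_rot a b c : inradius a b c = inradius b c a.
Proof. by rewrite /inradius -(addrA a) (addrC a) -(mulrA a) (mulrC a). Qed.

Lemma inradius_gt0 a b c : 0 < a -> 0 < b -> 0 < c -> 0 < inradius a b c.
Proof. by move=> *; rewrite sqrtr_gt0 divr_gt0 ?mulr_gt0 ?addr_gt0. Qed.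

Lemma inradius_sqr a b c : 0 < a -> 0 < b -> 0 < c ->
  inradius a b c ^+ 2 = a * b * c / (a + b + c).
Proof.
by move=> *; rewrite sqr_sqrtr// ltW// divr_gt0 ?mulr_gt0 ?addr_gt0.
Qed.

(** Both sides are twice the area over the product of the two sides at the vertex. *)
Lemma tri_sinE a b c : 0 < a -> 0 < b -> 0 < c ->
  Num.sqrt (1 - tri_cos a b c ^+ 2) =
  2 * inradius a b c * (a + b + c) / ((a + b) * (a + c)).
Proof.
move=> a0 b0 c0.
have s0 := inradius_gt0 a0 b0 c0; have s2 := inradius_sqr a0 b0 c0.
rewrite tri_cosE//.
rewrite (_ : 1 - _ =
  (2 * inradius a b c * (a + b + c) / ((a + b) * (a + c))) ^+ 2); last first.
  rewrite !exprMn s2 exprVn; field.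
  by rewrite !lt0r_neq0 ?addr_gt0.
rewrite sqrtr_sqr ger0_norm// ltW//.
by rewrite divr_gt0 ?mulr_gt0 ?addr_gt0 ?inradius_gt0.
Qed.

Lemma tri_cos_itv a b c : 0 < a -> 0 < b -> 0 < c -> -1 < tri_cos a b c < 1.
Proof.
move=> a0 b0 c0; rewrite tri_cosE//.
have d0 : 0 < (a + b) * (a + c) by rewrite mulr_gt0 ?addr_gt0.
have y0 : 0 < b * c / ((a + b) * (a + c)).
  by rewrite divr_gt0 ?mulr_gt0 ?addr_gt0.
have y1 : b * c / ((a + b) * (a + c)) < 1.
  rewrite ltr_pdivrMr// mul1r.
  have := mulr_gt0 a0 a0; have := mulr_gt0 a0 b0; have := mulr_gt0 a0 c0.
  by nra.
by apply/andP; split; lra.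
Qed.

(** The squared inradius is below $ab$, and $ab \le (a+b)^2/4$. *)
Lemma inradius_le a b c : 0 < a -> 0 < b -> 0 < c ->
  inradius a b c / (a + b) <= 1 / 2.
Proof.
move=> a0 b0 c0; rewrite ler_pdivrMr ?addr_gt0//.
have s0 := inradius_gt0 a0 b0 c0; have s2 := inradius_sqr a0 b0 c0.
have ab0 : 0 < 1 / 2 * (a + b) by rewrite !mulr_gt0 ?addr_gt0.
rewrite -ler_sqr ?nnegrE ?(ltW s0) ?(ltW ab0)// s2 ler_pdivrMr ?addr_gt0//.
have := mulr_ge0 (ltW c0) (sqr_ge0 (a - b)).
have := exprn_gt0 3 (addr_gt0 a0 b0).
by nra.
Qed.

(** The weights are logarithmic derivatives of the radii; only their differences occur, since angles
    are invariant under scaling. *)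
Lemma is_derive_tri_angle (A B C : R -> R) (x wa wb wc : R) :
  (forall t, 0 < A t) -> (forall t, 0 < B t) -> (forall t, 0 < C t) ->
  is_derive x 1 A (wa * A x) -> is_derive x 1 B (wb * B x) ->
  is_derive x 1 C (wc * C x) ->
  is_derive x 1 (fun t => acos (tri_cos (A t) (B t) (C t)))
    (inradius (A x) (B x) (C x) *
       ((wb - wa) / (A x + B x) + (wc - wa) / (A x + C x))).
Proof.
move=> A0 B0 C0 dA dB dC.
have a0 := A0 x; have b0 := B0 x; have c0 := C0 x.
have P0 : (A x + B x) * (A x + C x) != 0.
  by rewrite lt0r_neq0 ?mulr_gt0 ?addr_gt0.
have df : is_derive x 1 (fun t => tri_cos (A t) (B t) (C t))
   (- 2 * (B x * C x / ((A x + B x) * (A x + C x))) * A x *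
      ((wb - wa) / (A x + B x) + (wc - wa) / (A x + C x))).
  rewrite (_ : (fun t => _) = cst 1 - 2 *: ((B * C) *
     (fun t => (((A + B) * (A + C)) t)^-1))); last first.
    by apply/funext => t; rewrite tri_cosE.
  have dV := is_deriveV (f := (A + B) * (A + C)) P0
    (is_deriveM (is_deriveD dA dB) (is_deriveD dA dC)).
  apply: is_derive_eq.
  rewrite /GRing.scale/=.
  rewrite -[(B * C) x]/(B x * C x).
  rewrite -[((A + B) * (A + C)) x]/((A x + B x) * (A x + C x)).
  rewrite -[(A + B) x]/(A x + B x) -[(A + C) x]/(A x + C x); field.
  by rewrite !lt0r_neq0 ?addr_gt0.
apply: (is_derive_eq (is_derive1_comp (f := acos)
  (g := fun t => tri_cos (A t) (B t) (C t))
  (is_derive1_acos (tri_cos_itv a0 b0 c0)) df)).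
have s0 := inradius_gt0 a0 b0 c0; have s2 := inradius_sqr a0 b0 c0.
rewrite tri_sinE//.
set s := inradius _ _ _ in s0 s2 *.
(* The derivative of [acos] leaves $s$ in a denominator; with $s^2/s$ on this side too, the radical
   enters only through $s^2$, which is rational. *)
have -> : s * ((wb - wa) / (A x + B x) + (wc - wa) / (A x + C x)) =
  s ^+ 2 / s * ((wb - wa) / (A x + B x) + (wc - wa) / (A x + C x)).
  by rewrite expr2 mulfK// lt0r_neq0.
rewrite s2; field.
by rewrite !lt0r_neq0 ?addr_gt0.
Qed.

End Triangle.

(** * Conductances and the Caccioppoli inequality on one face *)

Section Face.
Variable R : realType.
Implicit Types a b c : R.

Lemma conductance_ge lo hi a b c : 0 < lo ->
  lo <= a <= hi -> lo <= b <= hi -> lo <= c <= hi ->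
  Num.sqrt (lo ^+ 3 / (3 * hi)) / (2 * hi) <= inradius a b c / (a + b).
Proof.
move=> lo0 /andP[la ha] /andP[lb hb] /andP[lc hc].
have a0 := lt_le_trans lo0 la; have b0 := lt_le_trans lo0 lb.
have c0 := lt_le_trans lo0 lc; have hi0 := lt_le_trans a0 ha.
apply: ler_pM; rewrite ?sqrtr_ge0 ?invr_ge0 ?mulr_ge0 ?(ltW hi0)//; last first.
  by rewrite lef_pV2 ?posrE ?mulr_gt0 ?addr_gt0//; lra.
rewrite ler_sqrt; last by rewrite divr_ge0 ?mulr_ge0 ?addr_ge0 ?ltW.
apply: ler_pM; rewrite ?exprn_ge0 ?invr_ge0 ?mulr_ge0 ?(ltW hi0) ?(ltW lo0)//.
  rewrite !exprS expr0 mulr1 mulrA.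
  by rewrite !ler_pM ?mulr_ge0 ?(ltW lo0).
by rewrite lef_pV2 ?posrE ?mulr_gt0 ?addr_gt0//; lra.
Qed.

Lemma expR_segment_bound a w : 0 < a -> exists2 lohi : R * R, 0 < lohi.1 &
  forall t, 0 <= t <= 1 -> lohi.1 <= a * expR (t * w) <= lohi.2.
Proof.
move=> a0; exists (a * expR (- `|w|), a * expR `|w|); rewrite /=.
  by rewrite mulr_gt0 ?expR_gt0.
move=> t /andP[t0 t1]; rewrite !ler_pM2l// !ler_expR -ler_norml normrM.
by rewrite (ger0_norm t0) ler_piMl.
Qed.

(** The time given by the mean value theorem will depend on the test function, so the lower bound
    has to be uniform in [t]. *)
Lemma conductance_segment_bound a b c wa wb wc : 0 < a -> 0 < b -> 0 < c ->
  exists2 m, 0 < m & forall t, 0 <= t <= 1 ->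
    let a' := a * expR (t * wa) in let b' := b * expR (t * wb) in
    let c' := c * expR (t * wc) in
    [/\ m <= inradius a' b' c' / (a' + b'), m <= inradius a' b' c' / (b' + c')
      & m <= inradius a' b' c' / (c' + a')].
Proof.
move=> a0 b0 c0.
have [[la ha] /= la0 Ha] := expR_segment_bound wa a0.
have [[lb hb] /= lb0 Hb] := expR_segment_bound wb b0.
have [[lc hc] /= lc0 Hc] := expR_segment_bound wc c0.
pose lo := Num.min la (Num.min lb lc); pose hi := Num.max ha (Num.max hb hc).
have lo0 : 0 < lo by rewrite !lt_min la0 lb0 lc0.
have hi0 : 0 < hi.
  have /andP[l h] : la <= a * expR (0 * wa) <= ha.
    by apply: Ha; rewrite lexx ler01.
  by rewrite !lt_max (lt_le_trans la0 (le_trans l h)).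
exists (Num.sqrt (lo ^+ 3 / (3 * hi)) / (2 * hi)).
  by rewrite divr_gt0 ?sqrtr_gt0 ?divr_gt0 ?exprn_gt0 ?mulr_gt0.
move=> t t01.
set a' := a * _; set b' := b * _; set c' := c * _.
have A : lo <= a' <= hi.
  by have /andP[l h] := Ha t t01; rewrite !ge_min l !le_max h.
have B : lo <= b' <= hi.
  by have /andP[l h] := Hb t t01; rewrite !ge_min l !le_max h !orbT.
have C : lo <= c' <= hi.
  by have /andP[l h] := Hc t t01; rewrite !ge_min l !le_max h !orbT.
split; first exact: conductance_ge.
  by rewrite inradius_rot; exact: conductance_ge.
by rewrite inradius_rot inradius_rot; exact: conductance_ge.
Qed.

(* The conductances are those of the labels [rho ^ (1 - t) * rhot ^ t] at one
   common time [t], provided by the mean value theorem; taking the same [t] at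
   the three corners is what makes them symmetric. *)
Lemma angle_variation (V : choiceType) (rho rhot : V -> R) (i j k : V) :
  (forall v, 0 < rho v) -> (forall v, 0 < rhot v) ->
  let w v := ln (rhot v / rho v) in
  exists2 m, 0 < m & forall f : V -> R, exists x y z : R,
    [/\ m <= x <= 1 / 2, m <= y <= 1 / 2, m <= z <= 1 / 2 &
    f i * (angle3 rhot i j k - angle3 rho i j k) +
    f j * (angle3 rhot j k i - angle3 rho j k i) +
    f k * (angle3 rhot k i j - angle3 rho k i j) =
    x * ((f i - f j) * (w j - w i)) + y * ((f j - f k) * (w k - w j)) +
    z * ((f k - f i) * (w i - w k))].
Proof.
move=> rho0 rhot0 w.
have [m m0 Hm] := conductance_segment_bound (w i) (w j) (w k)
  (rho0 i) (rho0 j) (rho0 k).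
exists m => // f.
pose r v t := rho v * expR (t * w v).
have r_gt0 v t : 0 < r v t by rewrite mulr_gt0 ?expR_gt0.
have r0 v : r v 0 = rho v by rewrite /r mul0r expR0 mulr1.
have r1 v : r v 1 = rhot v.
  by rewrite /r mul1r lnK ?posrE ?divr_gt0// mulrC divfK// lt0r_neq0.
have dr v (t : R) : is_derive t 1 (r v) (w v * r v t).
  rewrite /r.
  have d1 : is_derive t 1 (fun s : R => s * w v) (w v).
    rewrite (_ : (fun s => _) = w v \*: id); last first.
      by apply/funext => s; rewrite /= mulrC.
    by apply: is_derive_eq; rewrite /GRing.scale/= mulr1.
  have d2 := is_derive1_comp (f := expR) (g := fun s => s * w v)
    (is_derive_expR (t * w v)) d1.
  rewrite (_ : (fun s => _) = rho v \*: (expR \o (fun s => s * w v)))//.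
  by apply: is_derive_eq; rewrite /GRing.scale/=; ring.
pose g (a b c : V) t := acos (tri_cos (r a t) (r b t) (r c t)).
pose dg (a b c : V) t := inradius (r a t) (r b t) (r c t) *
       ((w b - w a) / (r a t + r b t) + (w c - w a) / (r a t + r c t)).
have dgE (a b c : V) (t : R) : is_derive t 1 (g a b c) (dg a b c t).
  by apply: is_derive_tri_angle.
pose G t := f i * g i j k t + f j * g j k i t + f k * g k i j t.
pose dG t := f i * dg i j k t + f j * dg j k i t + f k * dg k i j t.
have dGE (t : R) : is_derive t 1 G (dG t).
  rewrite (_ : G = f i \*: g i j k + f j \*: g j k i + f k \*: g k i j)//.
  by apply: is_derive_eq.
have cG : {within `[0 : R, 1], continuous G}.
  apply: continuous_subspaceT => t.
  apply: differentiable_continuous; apply/derivable1_diffP.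
  by have [] := dGE t.
have [t] := MVT ltr01 (fun t _ => dGE t) cG.
rewrite in_itv/= => /andP[t0 t1].
have t01 : 0 <= t <= 1 by rewrite !ltW.
rewrite subr0 mulr1 => EG.
have [Hx Hy Hz] := Hm t t01.
rewrite -/(r i t) -/(r j t) -/(r k t) in Hx Hy Hz.
exists (inradius (r i t) (r j t) (r k t) / (r i t + r j t)),
  (inradius (r i t) (r j t) (r k t) / (r j t + r k t)),
  (inradius (r i t) (r j t) (r k t) / (r k t + r i t)).
split.
- by rewrite Hx inradius_le.
- by rewrite Hy inradius_rot inradius_le.
- by rewrite Hz inradius_rot inradius_rot inradius_le.
have -> : f i * (angle3 rhot i j k - angle3 rho i j k) +
    f j * (angle3 rhot j k i - angle3 rho j k i) +
    f k * (angle3 rhot k i j - angle3 rho k i j) = G 1 - G 0.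
  rewrite /G /g !r0 !r1 /angle3 /tri_cos; ring.
(* Inradius and edge lengths are brought to one spelling, so that the coefficients from the two ends
   of an edge coincide. *)
rewrite EG /dG /dg -(inradius_rot (r i t)) (inradius_rot (r k t)).
rewrite (addrC (r i t) (r k t)) (addrC (r j t) (r i t)) (addrC (r k t) (r j t)).
ring.
Qed.

(** For positive [h] this is $h_u h_v (f_u/h_u - f_v/h_v)^2$, the energy of $f/h$ across the edge
    with weight $h_u h_v$. *)
Definition edge_defect (V : choiceType) (h f : V -> R) (u v : V) : R :=
  (f u * h v - f v * h u) ^+ 2 / (h u * h v).

(** Picone's identity splits the product into $(f_i-f_j)^2$ minus the defect; the upper bound on [x]
    is spent on the former, the lower bound on the latter. *)
Lemma caccioppoli_edge (m x hi hj fi fj : R) : 0 < hi -> 0 < hj ->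
  m <= x <= 1 / 2 ->
  x * ((fi ^+ 2 / hi - fj ^+ 2 / hj) * (hi - hj)) <=
  1 / 2 * (fi - fj) ^+ 2 - m * ((fi * hj - fj * hi) ^+ 2 / (hi * hj)).
Proof.
move=> hi0 hj0 /andP[mx x2].
have -> : (fi ^+ 2 / hi - fj ^+ 2 / hj) * (hi - hj) =
    (fi - fj) ^+ 2 - (fi * hj - fj * hi) ^+ 2 / (hi * hj).
  by field; rewrite !lt0r_neq0.
rewrite mulrBr lerB// ler_wpM2r ?sqr_ge0//.
by rewrite divr_ge0 ?sqr_ge0 ?mulr_ge0 ?ltW.
Qed.

Lemma caccioppoli_face (V : choiceType) (rho rhot : V -> R) (M : R)
    (i j k : V) :
  (forall v, 0 < rho v) -> (forall v, 0 < rhot v) ->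
  let h v := M - ln (rhot v / rho v) in
  (forall v, 0 < h v) ->
  exists2 m, 0 < m & forall f : V -> R,
    f i ^+ 2 / h i * (angle3 rhot i j k - angle3 rho i j k) +
    f j ^+ 2 / h j * (angle3 rhot j k i - angle3 rho j k i) +
    f k ^+ 2 / h k * (angle3 rhot k i j - angle3 rho k i j) <=
    1 / 2 * ((f i - f j) ^+ 2 + (f j - f k) ^+ 2 + (f k - f i) ^+ 2) -
    m * (edge_defect h f i j + edge_defect h f j k + edge_defect h f k i).
Proof.
move=> rho0 rhot0 h h0.
have [m m0 Hm] := angle_variation i j k rho0 rhot0.
exists m => // f.
have [x [y [z [Hx Hy Hz ->]]]] := Hm (fun v => f v ^+ 2 / h v).
have e u v : ln (rhot v / rho v) - ln (rhot u / rho u) = h u - h v.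
  by rewrite /h; ring.
rewrite !e.
have := caccioppoli_edge (f i) (f j) (h0 i) (h0 j) Hx.
have := caccioppoli_edge (f j) (f k) (h0 j) (h0 k) Hy.
have := caccioppoli_edge (f k) (f i) (h0 k) (h0 i) Hz.
rewrite /edge_defect; lra.
Qed.

End Face.

(** * Cutoff functions on a recurrent graph *)

Lemma probability1_setI (R : realType) (d : measure_display)
    (T : measurableType d) (P : probability T R) (C A : set T) :
  P C = 1%E -> measurable C -> measurable A -> P (C `&` A) = P A.
Proof.
move=> PC mC mA; have mD : measurable (A `\` C) by exact: measurableD.
have D0 : P (A `\` C) = 0%E.
  have C0 : P (~` C) = 0%E by rewrite probability_setC// PC subee.
  apply/eqP; rewrite -measure_le0 -C0 le_measure ?inE//.
  by exact: measurableC.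
rewrite -[in RHS](setUIDK A C) measureU0//; last exact: measurableI.
by rewrite setIC.
Qed.

(** * Law of the simple random walk *)

Section Walk.
Variables (R : realType) (V : choiceType) (adj : V -> V -> Prop).
Hypothesis adj_fin : forall v, finite_set [set u | adj v u].
Hypothesis degree_gt0 : forall v, (0 < degree adj v)%N.

Definition nb (v : V) : {fset V} := fset_set [set u | adj v u].

Lemma in_nb v u : (u \in nb v) = `[< adj v u >].
Proof. by rewrite in_fset_set//; apply/idP/asboolP; rewrite inE. Qed.

Lemma sum_nb_cst v (a : R) : \sum_(u <- nb v) a = (degree adj v)%:R * a.
Proof.
by rewrite big_const_seq count_predT iter_addr_0 mulr_natl.
Qed.

(** Transition probabilities, unfolded at the first step so that the Laplacian can later be taken in
    the starting vertex. *)
Fixpoint nstep (n : nat) (u v : V) : R :=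
  if n is n'.+1 then (degree adj u)%:R^-1 * \sum_(z <- nb u) nstep n' z v
  else (u == v)%:R.

Lemma nstep_ge0 n u v : 0 <= nstep n u v.
Proof.
elim: n u => [|n IH] u /=; first by rewrite ler0n.
by rewrite mulr_ge0 ?invr_ge0 ?ler0n ?sumr_ge0.
Qed.

Section Law.
Variables (x : V) (d : measure_display) (T : measurableType d).
Variables (P : probability T R) (X : nat -> T -> V).
Hypothesis walkX : simple_random_walk adj x P X.

Let cyl n (p : nat -> V) := [set w | forall i, (i <= n)%N -> X i w = p i].
Let ext n (p : nat -> V) z := fun i => if (i <= n)%N then p i else z.

Let measX n v : measurable (X n @^-1` [set v]).
Proof. by have [+ _] := walkX; apply. Qed.

Let cyl_ext n p z : cyl n.+1 (ext n p z) = cyl n p `&` X n.+1 @^-1` [set z].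
Proof.
apply/seteqP; split=> [w Hw|w [Hw HX] i].
  split=> [i Hi|]; first by rewrite Hw ?(leq_trans Hi)// /ext Hi.
  by rewrite /= Hw// /ext ltnn.
by rewrite leq_eqVlt /ext => /predU1P[->|/[!ltnS] Hi]; rewrite ?ltnn// Hi Hw.
Qed.

Let measC n p : measurable (cyl n p).
Proof.
elim: n p => [|n IH] p.
  rewrite (_ : cyl 0 p = X 0%N @^-1` [set p 0%N]).
    exact: measX.
  apply/seteqP; split=> [w Hw|w Hw i]; first exact: Hw.
  by rewrite leqn0 => /eqP ->.
have -> : cyl n.+1 p = cyl n.+1 (ext n p (p n.+1)).
  apply/seteqP; split=> w Hw i Hi; rewrite Hw// /ext; case: ltnP => // ni.
    by have -> : i = n.+1 by apply/eqP; rewrite eqn_leq Hi.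
  by have -> : i = n.+1 by apply/eqP; rewrite eqn_leq Hi.
by rewrite cyl_ext; apply: measurableI => //; exact: IH.
Qed.

Let P_ext n p z : adj (p n) z ->
  P (cyl n.+1 (ext n p z)) = (P (cyl n p) * ((degree adj (p n))%:R^-1)%:E)%E.
Proof.
move=> az; have [_ law] := walkX; rewrite !law -EFinM; congr EFin.
rewrite big_ord_recr/= /ext /= leqnn ltnn mulrA; congr (_ * _ * _).
  by apply: eq_bigr => i _; rewrite (ltnW (ltn_ord i)) ltn_ord.
by rewrite /step; case: asboolP.
Qed.

Let triv_ext n p A : trivIset A (fun z => cyl n.+1 (ext n p z)).
Proof.
move=> z z' _ _ [w [/= Hz Hz']].
by have := Hz n.+1 (leqnn _); rewrite Hz'// /ext ltnn.
Qed.

(** The continuations to neighbors exhaust the cylinder up to a null set. This avoids a sum over all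
    of [V], which is not assumed countable. *)
Let P_bigcup_ext n p :
  P (\bigcup_(z in [set u | adj (p n) u]) cyl n.+1 (ext n p z)) = P (cyl n p).
Proof.
rewrite measure_fin_bigcup//.
rewrite fsbig_finite//= -/(nb (p n)).
have -> : (\sum_(z <- nb (p n)) P (cyl n.+1 (ext n p z)) =
  \sum_(z <- nb (p n)) P (cyl n p) * ((degree adj (p n))%:R^-1)%:E)%E.
  rewrite big_seq [RHS]big_seq; apply: eq_bigr => z.
  by rewrite in_nb => /asboolP; exact: P_ext.
have [_ law] := walkX; rewrite law -EFinM sumEFin sum_nb_cst.
rewrite mulrCA mulfV ?mulr1//.
by rewrite pnatr_eq0 -lt0n.
Qed.

(** Markov property at time [n], by induction on [k]: the cylinder is split according to the next
    vertex, almost surely a neighbor of [p n]. *)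
Lemma walk_cyl_law k n p v :
  P (cyl n p `&` X (n + k)%N @^-1` [set v]) =
  (P (cyl n p) * (nstep k (p n) v)%:E)%E.
Proof.
elim: k n p => [|k IH] n p.
  rewrite addn0 /=; case: eqVneq => [<-|pv].
    rewrite mule1; congr (P _); apply/setIidPl => w Hw; exact: Hw.
  rewrite mule0 (_ : _ `&` _ = set0) ?measure0// -subset0 => w [Hw /= Xv].
  by move/eqP: pv; apply; rewrite -Xv Hw.
set N := [set u | adj (p n) u].
set E := \bigcup_(z in N) cyl n.+1 (ext n p z).
have mE : measurable E.
  by apply: fin_bigcup_measurable => [|z _]; [exact: adj_fin|exact: measC].
have EC : E `<=` cyl n p by move=> w [z _]; rewrite cyl_ext => -[].
set A := X _ @^-1` _; have mA : measurable A by exact: measX.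
have mC := measC n p.
have D0 : P (cyl n p `\` E) = 0%E.
  rewrite measureD//; last by rewrite ltey_eq fin_num_measure.
  rewrite (setIidr EC) [X in (_ - X)%E](P_bigcup_ext n p).
  by rewrite subee// fin_num_measure.
have -> : P (cyl n p `&` A) = P (E `&` A).
  have -> : cyl n p `&` A = (E `&` A) `|` ((cyl n p `\` E) `&` A).
    by rewrite -setIUl setDUK.
  rewrite measureU0//; try by apply: measurableI => //; apply: measurableD.
  apply/eqP; rewrite -measure_le0 -D0 le_measure ?inE//.
  - by apply: measurableI => //; apply: measurableD.
  - by apply: measurableD.
rewrite setI_bigcupl measure_fin_bigcup//; first last.
- by move=> z _; apply: measurableI.
- by apply: trivIset_setIr; exact: triv_ext.
- exact: adj_fin.
rewrite fsbig_finite/=; last exact: adj_fin.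
rewrite -/(nb (p n)) big_seq.
have -> : (\sum_(z <- nb (p n) | z \in nb (p n))
     P (cyl n.+1 (ext n p z) `&` A) =
  \sum_(z <- nb (p n) | z \in nb (p n)) (P (cyl n p) *
     ((degree adj (p n))%:R^-1 * nstep k z v)%:E))%E.
  apply: eq_bigr => z; rewrite in_nb => /asboolP az.
  by rewrite /A -addSnnS IH P_ext// EFinM muleA /ext ltnn.
rewrite -big_seq; have [_ law] := walkX.
by rewrite law -EFinM mulr_sumr mulr_sumr -sumEFin.
Qed.

Lemma walk_law k v : P (X k @^-1` [set v]) = (nstep k x v)%:E.
Proof.
have P1 : P (cyl 0 (fun=> x)) = 1%E.
  by have [_ ->] := walkX; rewrite eqxx big_ord0 mulr1.
have := walk_cyl_law k 0 (fun=> x) v; rewrite P1 mul1e add0n => <-.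
by rewrite (probability1_setI P1)//; exact: measC.
Qed.

End Law.

End Walk.

Lemma big_mem_swap (R : realType) (V : choiceType) (F : V -> R)
    (A B : {fset V}) :
  \sum_(u <- A | u \in B) F u = \sum_(u <- B | u \in A) F u.
Proof.
rewrite -big_filter -[RHS]big_filter; apply: perm_big.
apply: uniq_perm; rewrite ?filter_uniq ?fset_uniq// => u.
by rewrite !mem_filter andbC.
Qed.

(** * Divergence of the Green function and its consequences *)

Section Recurrent.
Variables (R : realType) (V : choiceType) (adj : V -> V -> Prop).
Hypothesis adj_fin : forall v, finite_set [set u | adj v u].
Hypothesis degree_gt0 : forall v, (0 < degree adj v)%N.
Hypothesis recA : recurrent R adj.

Local Notation nstep := (nstep R adj).
Local Notation nb := (nb adj).

(** Borel-Cantelli: with bounded partial sums, [v] would almost surely be visited only finitely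
    often. *)
Lemma nstep_sum_unbounded x v (C : R) : exists N, C < \sum_(n < N) nstep n x v.
Proof.
apply: contrapT => /forallNP Hle.
have [d [T [P [X [walkX aeX]]]]] := recA x.
pose F n := X n @^-1` [set v].
have mF n : measurable (F n) by have [+ _] := walkX; apply.
have limF0 : P (lim_sup_set F) = 0%E.
  apply: lim_sup_set_cvg0 => //.
  apply: (@le_lt_trans _ _ C%:E); last exact: ltry.
  apply: lime_le.
    by apply: is_cvg_ereal_nneg_natsum => n _.
  near=> N.
  rewrite big_mkord (eq_bigr (fun n : 'I_N => (nstep n x v)%:E)); last first.
    by move=> n _; exact: (walk_law adj_fin degree_gt0 walkX).
  by rewrite sumEFin lee_fin leNgt; apply/negP/Hle.
have limFT : {ae P, forall w, lim_sup_set F w}.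
  apply: filterS aeX => w /(_ v) Hinf n _.
  apply: contrapT => Hn; apply: Hinf; apply: (sub_finite_set _ (finite_II n)).
  move=> k /= Xk; rewrite ltnNge; apply/negP => nk; apply: Hn.
  by exists k.
have [B [mB B0 sB]] := limFT.
have mL : measurable (lim_sup_set F).
  by apply: bigcap_measurable => [|n _]; [exists 0%N|exact: bigcup_measurable].
have : (P setT <= P (B `|` lim_sup_set F))%E.
  apply: le_measure; rewrite ?inE//; first exact: measurableU.
  move=> w _; have [|nL] := pselect (lim_sup_set F w); first by right.
  by left; apply: sB.
rewrite measureU0// [leRHS]B0 [leLHS]probability_setT.
by rewrite lee_fin ler10.
Unshelve. all: by end_near. Qed.

(** Connectedness in the form used at the end: some [nstep n x v] is nonzero, which forces a path
    from [x] to [v], and [F] is preserved along it. *)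
Lemma adj_invariant_cst (S : Type) (F : V -> S) :
  (forall u v, adj u v -> F u = F v) -> forall x v, F x = F v.
Proof.
move=> HF x v; have [N] := nstep_sum_unbounded x v 0.
have nstepF n u : nstep n u v != 0 -> F u = F v.
  elim: n u => [|n IH] u /=.
    by case: (eqVneq u v) => [->|_] //=; rewrite eqxx.
  apply: contraNP => Fuv; rewrite big_seq big1 ?mulr0// => z.
  rewrite in_nb// => /asboolP auz; apply/eqP; apply: contraPT Fuv => /IH.
  by rewrite (HF _ _ auz) => ->; exact.
apply: contraPP => Fxv; rewrite big1 ?ltxx// => n _.
by apply/eqP; apply: contraPT Fxv => /nstepF ->; exact.
Qed.

Hypothesis adj_sym : forall u v, adj u v -> adj v u.

Lemma nstep_finite_support n v : finite_set [set u | nstep n u v != 0].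
Proof.
elim: n => [|n IH].
  apply: (sub_finite_set _ (finite_set1 v)) => u /=.
  by case: (eqVneq u v) => [->|_] //=; rewrite eqxx.
apply: (@sub_finite_set _ _
  (\bigcup_(z in [set z | nstep n z v != 0]) [set u | adj z u])).
  move=> u /= Hu; apply: contrapT => Nu; move: Hu; apply/negP; rewrite negbK.
  rewrite big_seq big1 ?mulr0// => z; rewrite in_nb// => /asboolP az.
  apply/eqP/negPn/negP => Hz; apply: Nu; exists z => //; exact: adj_sym.
by apply: bigcup_finite.
Qed.

(** Averaging over neighbors turns [nstep n] into [nstep n.+1], so the sum telescopes to times 0 and
    [N]. *)
Lemma sum_nstep_laplacian N u o :
  (degree adj u)%:R * (\sum_(n < N) nstep n u o) -
  \sum_(z <- nb u) \sum_(n < N) nstep n z o =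
  (degree adj u)%:R * ((u == o)%:R - nstep N u o).
Proof.
have d0 : (degree adj u)%:R != 0 :> R by rewrite pnatr_eq0 -lt0n.
elim: N => [|N IH].
  rewrite big_ord0 big1 => [|z _]; last by rewrite big_ord0.
  by rewrite mulr0 subr0 /= subrr mulr0.
rewrite big_ord_recr [X in _ - X](eq_bigr (fun z =>
  \sum_(n < N) nstep n z o + nstep N z o)); last first.
  by move=> z _; rewrite big_ord_recr.
rewrite big_split/= [RHS]mulrBr mulVKf//; move: IH; lra.
Qed.

(** Summation by parts. It is only an inequality because edges leaving [W] are counted on the left
    in one direction instead of two. *)
Lemma dirichlet_le (f : V -> R) (W : {fset V}) :
  (forall v, v \notin W -> f v = 0) ->
  \sum_(v <- W) \sum_(u <- nb v) (f v - f u) ^+ 2 <=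
  2 * \sum_(v <- W) f v * ((degree adj v)%:R * f v - \sum_(u <- nb v) f u).
Proof.
move=> f0.
have swap : \sum_(v <- W) \sum_(u <- nb v) f u ^+ 2 <=
    \sum_(v <- W) (degree adj v)%:R * f v ^+ 2.
  have -> : \sum_(v <- W) \sum_(u <- nb v) f u ^+ 2 =
      \sum_(v <- W) \sum_(u <- W | u \in nb v) f u ^+ 2.
    apply: eq_bigr => v _; rewrite -big_mem_swap (bigID (mem W))/=.
    by rewrite [X in _ + X]big1 ?addr0// => u uW; rewrite f0// expr0n.
  rewrite (exchange_big_dep predT)//=; apply: ler_sum => u _.
  rewrite -sum_nb_cst.
  rewrite (eq_bigl (fun v => v \in nb u)); last first.
    by move=> v; rewrite !in_nb//; apply/asboolP/asboolP => /adj_sym.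
  rewrite big_mem_swap [leRHS](bigID (mem W))/= lerDl sumr_ge0// => v _.
  exact: sqr_ge0.
have e v : \sum_(u <- nb v) (f v - f u) ^+ 2 = \sum_(u <- nb v) f u ^+ 2 -
    (degree adj v)%:R * f v ^+ 2 +
    2 * (f v * ((degree adj v)%:R * f v - \sum_(u <- nb v) f u)).
  rewrite mulrBr mulr_sumr mulrBr mulr_sumr.
  rewrite (eq_bigr (fun u => f u ^+ 2 + f v ^+ 2 - 2 * (f v * f u))).
    by rewrite sumrB big_split/= sum_nb_cst//; ring.
  by move=> u _; ring.
rewrite (eq_bigr _ (fun v _ => e v)) big_split/= sumrB -mulr_sumr.
by rewrite gerDr subr_le0.
Qed.

(* The cutoff is the Green function of the first [N] steps with pole at [o],
   normalized to be 1 at [o]; its Laplacian is [delta_o] up to a term of good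
   sign, so its energy is of the order of the inverse of its value at [o]. *)
Lemma recurrent_cutoff (o : V) (e : R) : 0 < e ->
  exists (f : V -> R) (B : {fset V}), [/\ f o = 1,
    forall v, v \notin B -> f v = 0 &
    forall W : {fset V}, (B `<=` W)%fset ->
      \sum_(v <- W) \sum_(u <- nb v) (f v - f u) ^+ 2 <= e].
Proof.
move=> e0.
(* The energy will come out at most [2 * degree adj o / g o], whence this threshold for [g o]. *)
have [N HN] := nstep_sum_unbounded o o (2 * (degree adj o)%:R / e).
pose g u := \sum_(n < N) nstep n u o.
have g_ge0 u : 0 <= g u by apply: sumr_ge0 => n _; exact: nstep_ge0.
have go0 : 0 < g o.
  by apply: le_lt_trans HN; rewrite divr_ge0 ?mulr_ge0 ?ler0n ?(ltW e0).
have gfin : finite_set [set u | g u != 0].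
  apply: (@sub_finite_set _ _
    (\bigcup_(n in `I_N) [set u | nstep n u o != 0])).
    move=> u /= Hu; apply: contrapT => Nu; move: Hu; apply/negP; rewrite negbK.
    rewrite /g big1// => n _; apply/eqP/negPn/negP => Hn; apply: Nu.
    by exists n => //=.
  apply: bigcup_finite => [|n _]; first exact: finite_II.
  exact: nstep_finite_support.
pose B := fset_set [set u | g u != 0].
have gB v : v \notin B -> g v / g o = 0.
  rewrite in_fset_set// => /negP; rewrite inE => /negP; rewrite negbK.
  by move=> /eqP ->; rewrite mul0r.
exists (fun v => g v / g o), B; split => //; first by rewrite divff ?gt_eqF.
move=> W BW; apply: (le_trans (dirichlet_le _)).
  by move=> v vW; apply: gB; apply: contra vW => /(fsubsetP BW).
have lap v : (degree adj v)%:R * (g v / g o) - \sum_(u <- nb v) g u / g o =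
    (degree adj v)%:R * ((v == o)%:R - nstep N v o) / g o.
  by rewrite mulrA -mulr_suml -mulrBl sum_nstep_laplacian.
apply: (@le_trans _ _ (2 * \sum_(v <- W)
    (v == o)%:R * ((degree adj o)%:R / g o))).
  rewrite ler_pM2l//; apply: ler_sum => v _; rewrite lap.
  have gv : 0 <= g v / g o by rewrite divr_ge0.
  case: eqVneq => [->|vo].
    rewrite divff ?gt_eqF// !mul1r ler_pM2r ?invr_gt0//.
    by rewrite ler_piMr// gerDl oppr_le0 nstep_ge0.
  rewrite mul0r mulr_ge0_le0// sub0r mulrN mulNr oppr_le0.
  by rewrite divr_ge0 ?mulr_ge0 ?nstep_ge0.
rewrite -mulr_suml.
have s1 : \sum_(v <- W) (v == o)%:R <= 1 :> R.
  rewrite -natr_sum (_ : (\sum_(v <- W) (v == o))%N = count_mem o W).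
    by rewrite lern1 count_uniq_mem ?fset_uniq//; case: (_ \in _).
  by rewrite -sum1_count [RHS]big_mkcond.
apply: (@le_trans _ _ (2 * (1 * ((degree adj o)%:R / g o)))).
  by rewrite ler_pM2l// ler_wpM2r// divr_ge0.
rewrite mul1r mulrA ler_pdivrMr// -ler_pdivrMl// mulrC; exact: ltW.
Qed.

End Recurrent.

(** * Summation over the faces of the complex *)

Section SeqSums.
Variables (R : realType) (V : choiceType).

Lemma sum_undup_le (I : eqType) (s : seq I) (F : I -> R) :
  (forall x, 0 <= F x) -> \sum_(x <- undup s) F x <= \sum_(x <- s) F x.
Proof.
move=> F0; elim: s => [|a s IH] /=; first by rewrite !big_nil.
rewrite [leRHS]big_cons; case: ifP => _; last by rewrite big_cons lerD2l.
by apply: le_trans IH _; rewrite lerDr.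
Qed.

(** Thanks to the inequality, explicit lists of faces or corners need not be shown free of
    repetitions. *)
Lemma sum_fset_le_seq (I : choiceType) (A : {fset I}) (s : seq I) (F : I -> R) :
  A =i s -> (forall x, 0 <= F x) -> \sum_(x <- A) F x <= \sum_(x <- s) F x.
Proof.
move=> As F0; rewrite (perm_big (undup s)); first exact: sum_undup_le.
apply: uniq_perm; rewrite ?undup_uniq ?fset_uniq// => x.
by rewrite mem_undup As.
Qed.

Lemma sum_next (s : seq V) (F : V -> R) :
  uniq s -> \sum_(x <- s) F (next s x) = \sum_(x <- s) F x.
Proof.
move=> Us; rewrite -(big_map (next s) predT F); apply: perm_big.
apply: uniq_perm => //.
  by rewrite map_inj_uniq//; exact: can_inj (prev_next Us).
move=> y; apply/mapP/idP => [[x xs ->]|ys]; first by rewrite mem_next.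
by exists (prev s y); rewrite ?mem_prev ?next_prev.
Qed.

Lemma le_sum2 (A : seq V) (F : V -> V -> R) (a b : V) :
  (forall u v, 0 <= F u v) -> a \in A -> b \in A ->
  F a b <= \sum_(u <- A) \sum_(v <- A) F u v.
Proof.
move=> F0 aA bA.
have le1 (G : V -> R) c : (forall u, 0 <= G u) -> c \in A ->
    G c <= \sum_(u <- A) G u.
  move=> G0 cA; rewrite (big_rem c)//= lerDl sumr_ge0//.
apply: (le_trans (le1 _ _ (F0 a) bA)).
by apply: (le1 (fun u => \sum_(v <- A) F u v)) => // u; exact: sumr_ge0.
Qed.

End SeqSums.

Section EdgeDefect.
Variables (R : realType) (V : choiceType) (h f : V -> R).

Lemma edge_defectC u v : edge_defect h f u v = edge_defect h f v u.
Proof. by rewrite /edge_defect -sqrrN opprB (mulrC (h u)). Qed.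

Lemma edge_defect_id v : edge_defect h f v v = 0.
Proof. by rewrite /edge_defect subrr expr0n mul0r. Qed.

Lemma edge_defect_ge0 u v :
  (forall w, 0 < h w) -> 0 <= edge_defect h f u v.
Proof.
by move=> h0; rewrite divr_ge0 ?sqr_ge0// mulr_ge0// ltW.
Qed.

End EdgeDefect.

(** * Stars of vertices and sums over faces *)

Section Faces.
Variables (R : realType) (V : choiceType) (K : simplicial2 V).
Hypothesis intK : forall v, interior_vertex K v.
Implicit Types (rho : V -> R) (v : V) (t : {fset V}).

Definition star v : {fset {fset V}} := fset_set [set t | faces K t /\ v \in t].

Lemma neighbor_sym u v : neighbor K u v -> neighbor K v u.
Proof. by rewrite /neighbor fsetUC. Qed.

Lemma star_finite v : finite_set [set t | faces K t /\ v \in t].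
Proof.
have [s [_ _ _ Hf]] := intK v.
apply: (@sub_finite_set _ _ [set` [seq [fset v; u; next s u]%fset | u <- s]]).
  by move=> t /= /Hf[u us ->]; apply: map_f.
exact: finite_seq.
Qed.

Lemma in_star v t : reflect (faces K t /\ v \in t) (t \in star v).
Proof.
rewrite in_fset_set; last exact: star_finite.
by apply: (iffP idP); rewrite inE.
Qed.

Lemma angle_sumE rho v :
  angle_sum K rho v = \sum_(t <- star v) angle rho v t.
Proof. by rewrite /angle_sum fsbig_finite//; exact: star_finite. Qed.

Lemma neighbor_finite v : finite_set [set u | neighbor K v u].
Proof.
have [s [_ _ Hn _]] := intK v; apply: (sub_finite_set _ (finite_seq s)) => u /=.
by move/Hn.
Qed.

Lemma degree_neighbor_gt0 v : (0 < degree (neighbor K) v)%N.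
Proof.
have fv := neighbor_finite v; have [s [_ s2 Hn _]] := intK v.
case: s s2 Hn => [//|a s] _ Hn; rewrite /degree cardfs_gt0; apply/fset0Pn.
exists a; rewrite in_fset_set// inE; apply/Hn; exact: mem_head.
Qed.

Lemma neighbor_face v u : neighbor K v u ->
  exists t, [/\ faces K t, v \in t & u \in t].
Proof.
have [s [_ _ Hn Hf]] := intK v; move=> /Hn us.
have [] : faces K [fset v; u; next s u]%fset /\
    v \in [fset v; u; next s u]%fset.
  by apply/Hf; exists u.
by exists [fset v; u; next s u]%fset; split => //; rewrite !inE eqxx ?orbT.
Qed.

(** In the cycle around [v] each neighbor occurs once as [u] and once as [next s u], hence the
    factor 2. *)
Lemma sum_star_le v (q : V -> R) :
  (forall u, 0 <= q u) -> q v = 0 ->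
  \sum_(t <- star v) \sum_(u <- t) q u <= 2 * \sum_(u <- nb (neighbor K) v) q u.
Proof.
move=> q0 qv; have [s [Us _ Hn Hf]] := intK v.
have ts : star v =i [seq [fset v; u; next s u]%fset | u <- s].
  move=> t; apply/in_star/mapP; first by move=> /Hf[u us ->]; exists u.
  by move=> [u us ->]; apply/Hf; exists u.
apply: le_trans (sum_fset_le_seq ts _) _; first by move=> t; exact: sumr_ge0.
rewrite big_map [X in _ <= _ * X](perm_big s)/=; last first.
  apply: uniq_perm => // u.
  rewrite in_nb; last exact: neighbor_finite.
  by apply/asboolP/idP => /Hn.
rewrite mulr_natl mulr2n -[X in _ + X](sum_next q Us) -big_split/=.
apply: ler_sum => u _.
apply: le_trans (sum_fset_le_seq (s := [:: v; u; next s u]) _ q0) _.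
  by move=> w; rewrite !inE orbA.
by rewrite !big_cons big_nil qv add0r addr0.
Qed.

Lemma angle3C rho (i j k : V) : angle3 rho i j k = angle3 rho i k j.
Proof.
rewrite /angle3 (addrC ((rho i + rho j) ^+ 2)) (addrC (rho j) (rho k)).
by rewrite -!mulrA (mulrC (rho i + rho j)).
Qed.

(** The other two vertices are enumerated in an unknown order; [angle3C] covers both. *)
Lemma angle_triangle rho (i j k : V) t : uniq [:: i; j; k] ->
  t =i [:: i; j; k] -> angle rho i t = angle3 rho i j k.
Proof.
rewrite /= !inE negb_or => /and3P[/andP[ij ik] jk _] tE.
have : perm_eq (enum_fset (t `\ i)%fset) [:: j; k].
  apply: uniq_perm; rewrite ?fset_uniq//=; first by rewrite inE jk.
  move=> u; rewrite !inE tE !inE; case: (eqVneq u i) => [->|//] /=.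
  by rewrite (negbTE ij) (negbTE ik).
rewrite /angle; case: (enum_fset _) => [|a [|b [|c s]]] abjk;
  have //= := perm_size abjk.
have := perm_mem abjk a; have := perm_mem abjk b; have := perm_uniq abjk.
rewrite /= !inE !eqxx orbT /= jk !andbT.
move=> ab /esym/orP[]/eqP eb /esym/orP[]/eqP ea;
  move: ab; rewrite ea eb ?eqxx//.
by move=> _; rewrite angle3C.
Qed.

(* The double sums over the three corners of a face count every edge twice. *)
Lemma caccioppoli_sum rho rhot (M : R) t : faces K t ->
  (forall v, 0 < rho v) -> (forall v, 0 < rhot v) ->
  let h v := M - ln (rhot v / rho v) in
  (forall v, 0 < h v) ->
  exists2 m, 0 < m & forall f : V -> R,
    \sum_(v <- t) f v ^+ 2 / h v * (angle rhot v t - angle rho v t) <=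
    1 / 4 * (\sum_(v <- t) \sum_(u <- t) (f v - f u) ^+ 2) -
    m * (\sum_(v <- t) \sum_(u <- t) edge_defect h f v u).
Proof.
move=> Ft rho0 rhot0 h h0.
have Ct : size (enum_fset t) = 3%N := card_face Ft.
have Ut : uniq (enum_fset t) := fset_uniq t.
have tE : t =i enum_fset t by [].
case: (enum_fset t) Ct Ut tE => [|i [|j [|k [|l s]]]]// _ Ut tE.
have [m m0 Hm] := caccioppoli_face i j k rho0 rhot0 h0.
exists (m / 2) => [|f]; first by rewrite divr_gt0.
have rot (a b c : V) : uniq [:: a; b; c] -> t =i [:: a; b; c] ->
    uniq [:: b; c; a] /\ t =i [:: b; c; a].
  move=> Uabc tabc; split; first by rewrite -(rot_uniq 1) in Uabc.
  by move=> u; rewrite tabc -(mem_rot 1).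
have [Uj tj] := rot _ _ _ Ut tE; have [Uk tk] := rot _ _ _ Uj tj.
have := Hm f; rewrite !big_cons !big_nil.
rewrite !(angle_triangle _ Ut tE) !(angle_triangle _ Uj tj).
rewrite !(angle_triangle _ Uk tk) -/h.
rewrite !edge_defect_id (edge_defectC h f j i) (edge_defectC h f k j).
rewrite (edge_defectC h f i k) !subrr expr0n/=.
lra.
Qed.

Lemma sum_faces_vertices (T : {fset {fset V}}) (W : {fset V})
    (Q : V -> {fset V} -> R) :
  (forall t, t \in T -> faces K t) ->
  (forall t, t \in T -> (t `<=` W)%fset) ->
  \sum_(t <- T) \sum_(v <- t) Q v t =
  \sum_(v <- W) \sum_(t <- star v | t \in T) Q v t.
Proof.
move=> FT TW.
transitivity (\sum_(t <- T) \sum_(v <- W | v \in t) Q v t).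
  rewrite big_seq [RHS]big_seq; apply: eq_bigr => t /TW /fsubsetP tW.
  rewrite -big_mem_swap big_seq_cond [RHS]big_seq_cond; apply: eq_bigl => v.
  by case: (boolP (v \in t)) => // /tW ->.
rewrite (exchange_big_dep predT)//=; apply: eq_bigr => v _.
rewrite [RHS]big_mem_swap big_seq_cond [RHS]big_seq_cond; apply: eq_bigl => t.
case: (boolP (t \in T)) => //= /FT Ft.
by apply/idP/in_star => [|[]].
Qed.

(** * Comparison of the two labels through energies *)

Section Comparison.
Variables (rho rhot : V -> R) (M : R).
Hypothesis rho_gt0 : forall v, 0 < rho v.
Hypothesis rhot_gt0 : forall v, 0 < rhot v.
Hypothesis subK : subpacking K rhot (angle_sum K rho).
Let h v := M - ln (rhot v / rho v).
Hypothesis h_gt0 : forall v, 0 < h v.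

(** The face inequalities are added over all faces meeting [B], and the defect is kept only on one
    face containing [o] and [x]; thus [m] depends on the edge but not on [f]. *)
Lemma edge_estimate (o x : V) : neighbor K o x ->
  exists2 m, 0 < m & forall (f : V -> R) (B : {fset V}) (e : R),
    f o = 1 -> (forall v, v \notin B -> f v = 0) ->
    (forall W : {fset V}, (B `<=` W)%fset ->
      \sum_(v <- W) \sum_(u <- nb (neighbor K) v) (f v - f u) ^+ 2 <= e) ->
    m * edge_defect h f o x <= e /\ (f o - f x) ^+ 2 <= e.
Proof.
move=> ox; have [t0 [Ft0 ot0 xt0]] := neighbor_face ox.
have [m m0 Hm] := caccioppoli_sum Ft0 rho_gt0 rhot_gt0 h_gt0.
exists m => // f B e fo fB energy.
have oB : o \in B.
  by apply/negPn/negP => /fB; rewrite fo => /eqP; rewrite oner_eq0.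
(* [T] contains the full star of each vertex of [B], so that whole angle sums appear there; [W]
   holds all vertices of faces in [T]. *)
pose T := (\bigcup_(v <- B) star v)%fset.
pose W := (B `|` \bigcup_(t <- T) t)%fset.
have TP t : t \in T -> faces K t.
  by move=> /bigfcupP[v _ /in_star[]].
have TW t : t \in T -> (t `<=` W)%fset.
  move=> tT; apply/fsubsetP => v vt; rewrite inE; apply/orP; right.
  by apply/bigfcupP; exists t; rewrite ?tT.
have BT v t : v \in B -> t \in star v -> t \in T.
  by move=> vB tv; apply/bigfcupP; exists v; rewrite ?vB.
have t0T : t0 \in T by apply: (BT o) => //; apply/in_star.
have BW : (B `<=` W)%fset by exact: fsubsetUl.
have EW := energy W BW.
split; last first.
  have oW : o \in W by exact: (fsubsetP BW).
  have xo : x \in nb (neighbor K) o.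
    by rewrite in_nb; [apply/asboolP|exact: neighbor_finite].
  apply: le_trans EW; rewrite (big_rem o)//= (big_rem x)//= -addrA lerDl.
  rewrite addr_ge0 ?sumr_ge0// => v _; rewrite ?sumr_ge0// => *;
    exact: sqr_ge0.
pose c v t := f v ^+ 2 / h v * (angle rhot v t - angle rho v t).
pose Q v t := \sum_(u <- t) (f v - f u) ^+ 2.
have ET : \sum_(t <- T) \sum_(v <- t) Q v t <= 2 * e.
  rewrite (sum_faces_vertices _ TP TW).
  apply: (@le_trans _ _ (\sum_(v <- W) 2 *
     \sum_(u <- nb (neighbor K) v) (f v - f u) ^+ 2)); last first.
    by rewrite -mulr_sumr ler_pM2l.
  apply: ler_sum => v _.
  apply: le_trans (sum_star_le (q := fun u => (f v - f u) ^+ 2) _ _).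
  - rewrite [leRHS](bigID (mem T))/= lerDl sumr_ge0// => t _.
    by apply: sumr_ge0 => u _; exact: sqr_ge0.
  - by move=> u; exact: sqr_ge0.
  - by rewrite subrr expr0n.
(* Regrouped by vertices, the sum is zero off [B]; at a vertex of [B] it is $f^2/h$ times the gain
   in angle sum, nonnegative by the subpacking hypothesis. *)
have cT : 0 <= \sum_(t <- T) \sum_(v <- t) c v t.
  rewrite (sum_faces_vertices _ TP TW); apply: sumr_ge0 => v _.
  have [vB|/fB fv] := boolP (v \in B); last first.
    by rewrite big1// => t _; rewrite /c fv expr0n/= !mul0r.
  rewrite big_seq_cond (eq_bigl (fun t => t \in star v)); last first.
    by move=> t; case: (boolP (t \in star v)) => //= /(BT _ _ vB).
  rewrite -big_seq -mulr_sumr sumrB -!angle_sumE.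
  rewrite mulr_ge0 ?divr_ge0 ?sqr_ge0 ?(ltW (h_gt0 v))// subr_ge0.
  exact: subK.
have Hrest : \sum_(t <- (T `\ t0)%fset) \sum_(v <- t) c v t <=
    1 / 4 * \sum_(t <- (T `\ t0)%fset) \sum_(v <- t) Q v t.
  rewrite mulr_sumr big_seq [leRHS]big_seq; apply: ler_sum => t.
  rewrite !inE => /andP[_ /TP Ft].
  have [m' m'0 Hm'] := caccioppoli_sum Ft rho_gt0 rhot_gt0 h_gt0.
  apply: le_trans (Hm' f) _; rewrite gerDl oppr_le0 mulr_ge0 ?(ltW m'0)//.
  by apply: sumr_ge0 => v _; apply: sumr_ge0 => u _; exact: edge_defect_ge0.
have H0 := Hm f; rewrite -/h in H0.
have dle : edge_defect h f o x <=
    \sum_(v <- t0) \sum_(u <- t0) edge_defect h f v u.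
  by apply: le_sum2 => // u v; exact: edge_defect_ge0.
have {}dle := ler_wpM2l (ltW m0) dle.
have e0 : 0 <= e.
  apply: le_trans EW; apply: sumr_ge0 => v _; apply: sumr_ge0 => u _.
  exact: sqr_ge0.
(* Adding up gives $0 \le \frac14 \cdot 2e - m \cdot$ defect, with a factor 2 to spare. *)
move: cT ET; rewrite !(big_fsetD1 t0 t0T)/= /c /Q => cT ET.
rewrite /c in Hrest; rewrite /Q in Hrest.
lra.
Qed.

Hypothesis recK : recurrent R (neighbor K).

Lemma neighbor_potential_eq (o x : V) : neighbor K o x -> h o = h x.
Proof.
move=> ox; have [m m0 Hm] := edge_estimate ox.
apply/eqP; rewrite eq_sym -subr_eq0; apply: contraT => hne.
have a0 : 0 < (h x - h o) ^+ 2 by rewrite exprn_even_gt0.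
have ho := h_gt0 o; have hx := h_gt0 x.
(* Since $h_x - h_o = (h_x - f_x h_o) - (1 - f_x) h_o$, the two bounds of [edge_estimate] give
   $(h_x-h_o)^2 \le eC$. The energy [e] is chosen so that $eC$ is half of the left side, a
   contradiction. *)
pose C := 2 * (h o * h x / m + h o ^+ 2).
have C0 : 0 < C.
  by rewrite mulr_gt0// addr_gt0 ?divr_gt0 ?mulr_gt0 ?exprn_gt0.
have e0 : 0 < (h x - h o) ^+ 2 / (2 * C) by rewrite divr_gt0// mulr_gt0.
have [f [B [fo fB energy]]] :=
  recurrent_cutoff neighbor_finite degree_neighbor_gt0 recK neighbor_sym o e0.
have [] := Hm f B _ fo fB energy.
set e := _ / (2 * C) in e0 *.
rewrite /edge_defect fo mul1r.
rewrite mulrA ler_pdivrMr ?mulr_gt0// mulrC -ler_pdivlMr// => d1 d2.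
have ho2 : 0 < h o ^+ 2 by rewrite exprn_gt0.
have {}d2 := ler_wpM2r (ltW ho2) d2.
have eC : (h x - h o) ^+ 2 = 2 * (e * C).
  by rewrite /e; field; rewrite gt_eqF.
have sq : (h x - h o) ^+ 2 <=
   2 * ((h x - f x * h o) ^+ 2 + (1 - f x) ^+ 2 * h o ^+ 2).
  have := sqr_ge0 (h x - f x * h o + (1 - f x) * h o).
  rewrite -exprMn; set y := h x - f x * h o; set z := (1 - f x) * h o.
  by have -> : h x - h o = y - z; [rewrite /y /z; ring|lra].
have eCE : e * C = 2 * (e * (h o * h x) / m + e * h o ^+ 2).
  by rewrite /C; field; rewrite gt_eqF.
have := mulr_gt0 e0 C0.
lra.
Qed.

End Comparison.

End Faces.

Theorem theorem3p1 (R : realType) (V : choiceType) (K : simplicial2 V)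
    (D : set R[i]^o) (domD : plane_domain D) (triK : triangulation K D)
    (recK : recurrent R (neighbor K))
    (rho rhot : V -> R)
    (rho_gt0 : forall v, 0 < rho v) (rhot_gt0 : forall v, 0 < rhot v)
    (subK : subpacking K rhot (angle_sum K rho)) :
  bounded_fun (fun v => rhot v / rho v) <->
  exists c : R, forall v, rhot v / rho v = c.
Proof.
split=> [[M [_ HM]]|[c Hc]]; last first.
  exists `|c|; split; first exact: num_real.
  by move=> y cy v _ /=; rewrite Hc ltW.
have [_ _ intK _] := triK.
have A_gt0 v : 0 < rhot v / rho v by rewrite divr_gt0.
(* [bounded_fun] provides bounds strictly above [M] only; this one is also positive, so its
   logarithm can be used. *)
have A_le v : rhot v / rho v <= `|M| + 1.
  have := HM (`|M| + 1) _ v I; rewrite /= (gtr0_norm (A_gt0 v)); apply.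
  by rewrite (le_lt_trans (ler_norm M))// ltrDl.
(* The extra 1 makes the potential strictly positive, as division by it requires. *)
have h_gt0 v : 0 < ln (`|M| + 1) + 1 - ln (rhot v / rho v).
  have : ln (rhot v / rho v) <= ln (`|M| + 1).
    by rewrite ler_ln ?posrE// (lt_le_trans (A_gt0 v)).
  lra.
have step u v : neighbor K u v -> rhot u / rho u = rhot v / rho v.
  move=> /(neighbor_potential_eq intK rho_gt0 rhot_gt0 subK h_gt0 recK) huv.
  by apply: ln_inj; rewrite ?posrE//; lra.
have [V0|V0] := pselect ([set: V] !=set0); last first.
  by exists 0 => v; exfalso; apply: V0; exists v.
have [x _] := V0; exists (rhot x / rho x) => v.
exact: (adj_invariant_cst (neighbor_finite intK) (degree_neighbor_gt0 intK)
  recK step).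
Qed.
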